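(* Let $k \geq 3$ be a fixed integer, let $\mathcal{H}$ be a family of graphs, and let $g := g(\mathcal{H},k)$ (assumed finite). For each $n$ let $G = G_n$ be an $\mathcal{H}$-free $n$-vertex graph with maximum degree $\Delta := \Delta(n)$, and let $m := m(n)$ be a positive integer. If $m / \left(n^{2/(k(g+1))} \Delta^{2g/(k(g+1))}\right) \to \infty$ as $n \to \infty$ and $m \geq 3k^2\Delta$, then $G$ is a.a.s. $(k,m)$-colourable.
   Context: Given positive integers $k \leq m$ and a graph $G$, a random $(k,m)$-list-assignment $\mathcal{L} = \{L(v) : v \in V(G)\}$ assigns to each vertex $v$ a $k$-element subset $L(v)$ of $\{1,\ldots,m\}$ chosen uniformly at random, independently over vertices. $G$ is $\mathcal{L}$-colourable if there is a proper colouring $c$ with $c(v) \in L(v)$ for all $v$. An $n$-vertex graph $G$ is a.a.s. $(k,m)$-colourable if $\lim_{n\to\infty}\mathbb{P}(G \text{ is } \mathcal{L}\text{-colourable}) = 1$. A graph is $\mathcal{H}$-free if no $H \in \mathcal{H}$ is a (not necessarily induced) subgraph of it. A graph is $k$-choosable if it is $\mathcal{L}$-colourable for every assignment of lists of size $k$. For a positive integer $k$ and family $\mathcal{H}$, $g(\mathcal{H},k)$ is the largest integer $g$ such that every $\mathcal{H}$-free graph on at most $g$ vertices is $k$-choosable. *)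

(* Defs.v *)
From HB Require Import structures.
From mathcomp Require Import all_boot all_order all_algebra.
From mathcomp Require Import all_classical all_reals all_analysis.
Set Implicit Arguments. Unset Strict Implicit. Unset Printing Implicit Defensive.
Import Order.TTheory GRing.Theory Num.Theory.

Record sgraph := SGraph {
  gn : nat;
  gadj : rel 'I_gn;
  gadj_sym : symmetric gadj;
  gadj_irr : irreflexive gadj }.

Definition Hfree (HF : sgraph -> Prop) (V : finType) (adj : rel V) : Prop :=
  forall H, HF H ->
    ~ (exists f : 'I_(gn H) -> V,
          injective f /\ forall x y, @gadj H x y -> adj (f x) (f y)).

Definition L_colourable (V : finType) (adj : rel V) (L : V -> seq nat) : Prop :=
  exists c : V -> nat,
    (forall v, c v \in L v) /\ (forall u v, adj u v -> c u <> c v).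

Definition k_choosable (k : nat) (V : finType) (adj : rel V) : Prop :=
  forall L : V -> seq nat,
    (forall v, uniq (L v) /\ size (L v) = k) -> L_colourable adj L.

Definition small_choosable (HF : sgraph -> Prop) (k g : nat) : Prop :=
  forall (j : nat) (adj : rel 'I_j), j <= g ->
    symmetric adj -> irreflexive adj -> Hfree HF adj -> k_choosable k adj.

Definition is_g (HF : sgraph -> Prop) (k g : nat) : Prop :=
  small_choosable HF k g /\ forall g', small_choosable HF k g' -> g' <= g.

Definition maxdeg (n : nat) (adj : rel 'I_n) : nat :=
  \max_(v : 'I_n) #|[set u | adj v u]|.

Definition is_km_assignment (n k m : nat) (L : {ffun 'I_n -> {set 'I_m}}) : bool :=
  [forall v, #|L v| == k].

Definition km_colourable (n m : nat) (adj : rel 'I_n) (L : {ffun 'I_n -> {set 'I_m}}) : bool :=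
  [exists c : {ffun 'I_n -> 'I_m},
     [forall v, c v \in L v] && [forall u, forall v, adj u v ==> (c u != c v)]].

(* Probability that G is L-colourable for a uniformly random (k,m)-list
   assignment (independent uniform k-subsets at each vertex = uniform over
   all assignments). *)
Definition prob_km_colourable (R : realType) (n k m : nat) (adj : rel 'I_n) : R :=
  (#|[set L : {ffun 'I_n -> {set 'I_m}} | is_km_assignment k L && km_colourable adj L]|%:R
   / #|[set L : {ffun 'I_n -> {set 'I_m}} | is_km_assignment k L]|%:R)%R.

(* Main.v *)
Require Import Defs.
From HB Require Import structures.
From mathcomp Require Import all_boot all_order all_algebra.
From mathcomp Require Import all_classical all_reals all_analysis.
From mathcomp Require Import zify ring lra.
Import Order.TTheory GRing.Theory Num.Theory.
Import numFieldNormedType.Exports.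

Set Implicit Arguments. Unset Strict Implicit. Unset Printing Implicit Defensive.

(** If a list assignment [L] admits no colouring, take a minimal non-colourable
    vertex set [K].  Then [#|K| > g], every colour of [L v] with [v] in [K] occurs
    in a second list of [K], so that only [k * #|K| / 2] colours appear on [K],
    and [K] is connected in the conflict graph, whose edges are the edges of [G]
    with intersecting lists.
    - Connected sets of [s.+1] vertices number at most [n * (s * D) ^ s], and one of
      them sees at most [j = (k * s.+1)./2] colours with probability at most
      [m ^ j * (j / m) ^ (k * s.+1)].  Summing over [g <= s < S] with [S] of order
      [log n], the term [s = g] dominates; it is [O(n * D ^ g / m ^ (k * g.+1 / 2))],
      which is [o(1)] by the growth hypothesis.
    - A conflict edge has probability at most [k ^ 2 / m <= 1 / (3 * D)], so the
      exploration of a conflict component is dominated by a subcritical branching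
      process: it survives [S] steps with probability at most [3 * (e / 3) ^ S]. *)

(** * Random lists *)

Section RandomLists.
Variables (n m k : nat).
Notation lists := {ffun 'I_n -> {set 'I_m.+1}}.
Implicit Types (L : lists) (P F : lists -> bool) (U A : {set 'I_n}).

Definition nb_lists P : nat := #|[set L : lists | is_km_assignment k L && P L]|.

Lemma nb_listsS P F : (forall L, is_km_assignment k L -> P L -> F L) ->
  nb_lists P <= nb_lists F.
Proof.
move=> PF; apply/subset_leq_card/fintype.subsetP => L; rewrite !inE.
by case/andP=> kL pL; rewrite kL PF.
Qed.

Lemma nb_lists_has (I : eqType) (r : seq I) (P : I -> lists -> bool) :
  nb_lists (fun L => has (P^~ L) r) <= \sum_(i <- r) nb_lists (P i).
Proof.
elim: r => [|i r IH] /=; first by rewrite big_nil leqn0 cards_eq0;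
  apply/eqP/setP => L; rewrite !inE andbF.
rewrite big_cons; apply: leq_trans (leq_add (leqnn _) IH).
apply: leq_trans (leq_card_setU _ _).
by apply/subset_leq_card/fintype.subsetP => L; rewrite !inE; case: is_km_assignment.
Qed.

(** Measurability with respect to the lists on [U]: under such an event the lists outside [U] stay
    uniform and independent. *)
Definition depends_on U F :=
  forall L L' : lists, {in U, L =1 L'} -> F L = F L'.

Definition conflict L (u v : 'I_n) := ~~ [disjoint L u & L v].

(** The shift uses the cyclic group structure of ['I_m.+1], which is why the number of colours is
    written [m.+1]. *)
Definition shift_list (a : 'I_n) (i : 'I_m.+1) L : lists :=
  [ffun v => if v == a then [set (c + i)%R | c in L v] else L v].

Lemma shift_listK a i : cancel (shift_list a i) (shift_list a (- i)%R).
Proof.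
move=> L; apply/ffunP => v; rewrite !ffunE; case: eqP => // _.
by rewrite -imset_comp -[RHS]imset_id; apply: eq_imset => c /=; rewrite addrK.
Qed.

Lemma shift_list_km a i L : is_km_assignment k (shift_list a i L) = is_km_assignment k L.
Proof.
apply: eq_forallb => v; rewrite ffunE; case: ifP => // _.
by rewrite card_imset //; apply: addIr.
Qed.

(** A shift [i] for which [S + i] meets [T] is a difference [x - c] with [x] in [T] and [c] in
    [S]. *)
Lemma shift_meet_card (S T : {set 'I_m.+1}) :
  #|[set i | ~~ [disjoint T & [set (c + i)%R | c in S]]]| <= #|T| * #|S|.
Proof.
rewrite -cardsX.
apply: leq_trans (leq_imset_card (fun p : 'I_m.+1 * 'I_m.+1 => (p.1 - p.2)%R) _).
apply/subset_leq_card/fintype.subsetP => i; rewrite inE.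
case/pred0Pn => x /andP[xT /imsetP[c cS xE]].
apply/imsetP; exists (x, c); first by apply/setXP.
by rewrite /= xE addrAC subrr add0r.
Qed.

(* Cyclically shifting the colours of [L a] preserves the uniform measure, and
   at most [k ^ 2] of the [m.+1] shifts make [L a] meet [L q]. *)
Lemma nb_lists_conflict U F q a : depends_on U F -> q \in U -> a \notin U ->
  nb_lists (fun L => F L && conflict L q a) * m.+1 <= k ^ 2 * nb_lists F.
Proof.
move=> depF qU aU.
have qa : q == a = false by apply/eqP => qa; rewrite qa (negbTE aU) in qU.
have FS i L : F (shift_list a i L) = F L.
  apply: depF => v vU; rewrite ffunE; case: eqP => // va.
  by rewrite -va vU in aU.
have E i : nb_lists (fun L => F L && conflict L q a) =
           nb_lists (fun L => F L && conflict (shift_list a i L) q a).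
  rewrite /nb_lists -(card_imset _ (can_inj (shift_listK a (- i)%R))).
  apply: eq_card => L; rewrite !inE; apply/imsetP/idP.
    move=> [L']; rewrite inE => /and3P[kL' FL' cL'] ->.
    by rewrite shift_list_km FS kL' FL' -{1}(opprK i) shift_listK.
  move=> /and3P[kL FL cL]; exists (shift_list a i L); last by rewrite shift_listK.
  by rewrite inE shift_list_km FS kL FL.
(* Double counting of pairs of a shift and an assignment, first by shift, then by assignment. *)
rewrite -[X in _ * X]card_ord mulnC -sum_nat_const.
under eq_bigr => i _ do rewrite (E i) /nb_lists -sum1dep_card.
rewrite (exchange_big_dep (fun L => is_km_assignment k L && F L)) /=; last first.
  by move=> i L _ /and3P[-> ->].
rewrite /nb_lists -sum1dep_card big_distrr /= leq_sum // => L /andP[kL FL].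
rewrite kL FL /= sum1dep_card muln1.
rewrite (_ : [set _ | _] = [set i | ~~ [disjoint L q & [set (c + i)%R | c in L a]]]).
  by apply: leq_trans (shift_meet_card _ _) _; rewrite !(eqP (forallP kL _)).
by apply/setP => i; rewrite !inE /conflict !ffunE qa eqxx.
Qed.

Lemma depends_on_conflicts U F q A : depends_on U F -> q \in U ->
  depends_on (U :|: A) (fun L => F L && [forall a in A, conflict L q a]).
Proof.
move=> dF qU L L' LL'.
rewrite (dF L L') => [|v vU]; last by rewrite LL' // inE vU.
congr (_ && _); apply: eq_forallb_in => a aA.
by rewrite /conflict !LL' // inE ?qU ?aA ?orbT.
Qed.

(** Induction on [#|A|]: with the lists on [U] and on the rest of [A] revealed, the list of the next
    vertex is still uniform, so each vertex costs a factor [k ^ 2 / m.+1]. *)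
Lemma nb_lists_conflicts U F q A : depends_on U F -> q \in U -> [disjoint A & U] ->
  nb_lists (fun L => F L && [forall a in A, conflict L q a]) * m.+1 ^ #|A|
  <= (k ^ 2) ^ #|A| * nb_lists F.
Proof.
move=> dF qU; have [s] := ubnP #|A|; elim: s A => // s IH A sA.
have [->|[a aA]] := set_0Vmem A.
  rewrite cards0 !expn0 muln1 mul1n => _.
  by apply: nb_listsS => L _ /andP[].
move=> dAU; have aU : a \notin U by rewrite (disjointFr dAU aA).
have dA'U : [disjoint A :\ a & U] by apply: disjointWl dAU; exact: subsetDl.
have aA' : a \notin U :|: (A :\ a) by rewrite !inE eqxx (negbTE aU).
have cA : #|A| = #|A :\ a|.+1 by rewrite (cardsD1 a A) aA.
have := nb_lists_conflict (depends_on_conflicts (A := A :\ a) dF qU) (_ : q \in _) aA'.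
rewrite !inE qU => /(_ isT) H.
have {}IH := IH (A :\ a) _ dA'U.
rewrite -ltnS -cA in IH; move/(_ sA) in IH.
rewrite cA (expnS m.+1) (expnS (k ^ 2)).
apply: (@leq_trans (k ^ 2 * nb_lists (fun L => F L && [forall a0 in A :\ a, conflict L q a0])
    * m.+1 ^ #|A :\ a|)).
  rewrite mulnA leq_mul2r; apply/orP; right; apply: leq_trans H.
  rewrite leq_mul2r; apply/orP; right; apply: nb_listsS => L _ /andP[-> /forall_inP cL].
  rewrite (cL _ aA) andbT; apply/forall_inP => b /setD1P[_]; exact: cL.
rewrite -[X in X <= _]mulnA -[X in _ <= X]mulnA leq_mul2l.
by apply/orP; right; exact: IH.
Qed.

End RandomLists.

(** * Exploration of the conflict graph *)

Lemma sum_expr_subset (R : comNzRingType) (T : finType) (B : {set T}) (z : R) :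
  (\sum_(A : {set T} | A \subset B) z ^+ #|A| = (1 + z) ^+ #|B|)%R.
Proof.
rewrite -prodr_const [RHS]big_mkcond /=.
(* In the expanded product, a set [A] with a point outside [B] picks up a factor 0. *)
rewrite [RHS](eq_bigr (fun v => (if v \in B then z else 0) + 1)%R); last first.
  by move=> v _; case: ifP => _; rewrite ?add0r // addrC.
rewrite [RHS]bigA_distr /= [RHS](bigID (fun A : {set T} => A \subset B)) /=.
rewrite [X in (_ + X)%R]big1 ?addr0.
  apply: eq_bigr => A /fintype.subsetP AB.
  rewrite -prodr_const big_mkcond /=; apply: eq_bigr => v _.
  by case: ifP => // /AB ->.
move=> A /subsetPn[v vA vB]; rewrite (bigD1 v) //= vA (negbTE vB).
by rewrite mul0r.
Qed.

Section Exploration.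
Variables (n m k : nat) (adj : rel 'I_n).
Notation lists := {ffun 'I_n -> {set 'I_m.+1}}.
Implicit Types (L : lists) (F : lists -> bool) (U A : {set 'I_n}).

(* [t] steps of a breadth-first exploration of the conflict graph: [U] is the
   set of vertices seen so far and [Q] the queue of those still to be processed. *)
Fixpoint explore (t : nat) U (Q : seq 'I_n) L : bool :=
  if t is t'.+1 then
    if Q is q :: Q' then
      [exists A : {set 'I_n}, [&& A \subset [set u | adj q u] :\: U,
         [forall a in A, conflict L q a] & explore t' (U :|: A) (Q' ++ enum A) L]]
    else false
  else true.

Variables (R : realType) (D : nat).
Hypothesis degD : forall q, #|[set u | adj q u]| <= D.
(** [x] bounds the probability of one conflict. With weight 3 per queued vertex, weights being
    multiplied, [rho] bounds the expected factor gained in one step; 3 exceeds e, so [rho < 1] once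
    [3 * x * D <= 1]. *)
Let x : R := ((k ^ 2)%:R / m.+1%:R)%R.
Let rho : R := ((1 + 3 * x) ^+ D / 3)%R.

Lemma x_ge0 : (0 <= x)%R. Proof. by rewrite divr_ge0. Qed.

Lemma rho_ge0 : (0 <= rho)%R.
Proof. by rewrite divr_ge0 // exprn_ge0 // addr_ge0 // mulr_ge0 // x_ge0. Qed.

(* Each processed vertex trades a factor 3 for the new ones, and the sum
   over the possible sets [A] of new vertices is a binomial expansion. *)
Lemma nb_lists_explore t U Q F : depends_on U F -> {subset Q <= U} ->
  ((nb_lists k (fun L => F L && explore t U Q L))%:R
   <= 3 ^+ size Q * rho ^+ t * (nb_lists k F)%:R :> R)%R.
Proof.
elim: t U Q F => [|t IH] U Q F dF QU /=.
  rewrite mulr1; apply: (@le_trans _ _ (nb_lists k F)%:R%R).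
    by rewrite ler_nat; apply: nb_listsS => L _ /andP[].
  by rewrite ler_peMl // exprn_ege1 // ler1n.
case: Q QU => [|q Q] QU.
  rewrite (_ : nb_lists _ _ = 0); first by rewrite !mulr_ge0 // exprn_ge0 // rho_ge0.
  by apply/eqP; rewrite cards_eq0; apply/eqP/setP => L; rewrite !inE !andbF.
have qU : q \in U by apply: QU; rewrite inE eqxx.
set N := [set u | adj q u] :\: U.
pose P A L := (A \subset N) && ((F L && [forall a in A, conflict L q a])
                 && explore t (U :|: A) (Q ++ enum A) L).
apply: (@le_trans _ _ (\sum_(A : {set 'I_n}) (nb_lists k (P A))%:R)%R).
  rewrite -natr_sum ler_nat.
  apply: leq_trans (nb_lists_has _ _ _); apply: nb_listsS => L _.
  case/andP=> FL /existsP[A /and3P[AN cA eA]].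
  by apply/hasP; exists A; rewrite ?mem_index_enum // /P AN FL cA.
apply: (@le_trans _ _ (\sum_(A : {set 'I_n} | A \subset N)
   3 ^+ size Q * rho ^+ t * (nb_lists k F)%:R * (3 * x) ^+ #|A|)%R).
  rewrite [X in (_ <= X)%R]big_mkcond /=; apply: ler_sum => A _.
  case: ifP => AN; last first.
    rewrite (_ : nb_lists _ _ = 0) //.
    by apply/eqP; rewrite cards_eq0; apply/eqP/setP => L; rewrite !inE /P AN andbF.
  have dAU : [disjoint A & U].
    by move: AN; rewrite subsetD => /andP[].
  have sQ : {subset Q ++ enum A <= U :|: A}.
    move=> v; rewrite mem_cat mem_enum inE => /orP[vQ|->]; last by rewrite orbT.
    by rewrite QU // inE vQ orbT.
  apply: (@le_trans _ _ (nb_lists k (fun L =>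
     (F L && [forall a in A, conflict L q a]) && explore t (U :|: A) (Q ++ enum A) L))%:R%R).
    by rewrite ler_nat; apply: nb_listsS => L _ /andP[].
  apply: le_trans (IH _ _ _ (depends_on_conflicts (A := A) dF qU) sQ) _.
  rewrite size_cat -cardE exprD [((3 * x) ^+ _)%R]exprMn.
  have H : ((nb_lists k (fun L => F L && [forall a in A, conflict L q a]))%:R
            <= x ^+ #|A| * (nb_lists k F)%:R :> R)%R.
    rewrite /x expr_div_n mulrAC ler_pdivlMr ?exprn_gt0 ?ltr0n //.
    by rewrite -!natrX -!natrM ler_nat (nb_lists_conflicts k dF qU dAU).
  rewrite [leRHS](_ : _ = 3 ^+ size Q * 3 ^+ #|A| * rho ^+ t *
     (x ^+ #|A| * (nb_lists k F)%:R))%R; last by ring.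
  by rewrite ler_wpM2l // !mulr_ge0 ?exprn_ge0 ?rho_ge0.
rewrite -big_distrr /= sum_expr_subset.
rewrite [leRHS](_ : _ = 3 ^+ size Q * rho ^+ t * (nb_lists k F)%:R * (1 + 3 * x) ^+ D)%R.
  apply: ler_wpM2l; first by rewrite !mulr_ge0 ?exprn_ge0 ?rho_ge0.
  apply: ler_weXn2l; first by rewrite lerDl mulr_ge0 // x_ge0.
  by apply: leq_trans (degD q); apply: subset_leq_card; apply: subsetDl.
have <- : (3 * rho = (1 + 3 * x) ^+ D)%R by rewrite /rho mulrC divfK // pnatr_eq0.
by rewrite /= (exprS 3) (exprS rho); ring.
Qed.

End Exploration.

(** * Lists with few colours on a vertex set *)

Section FewColours.
Variables (n m k : nat).
Notation lists := {ffun 'I_n -> {set 'I_m.+1}}.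

(** After multiplication by [k!] the falling factorials compare factor by factor:
    [(c - i) * M <= c * (M - i)]. *)
Lemma bin_ratio_le c M : c <= M -> 'C(c, k) * M ^ k <= c ^ k * 'C(M, k).
Proof.
move=> cM; rewrite -(leq_pmul2r (fact_gt0 k)) mulnAC bin_ffact -mulnA bin_ffact.
elim: k => [//|i IH].
rewrite !ffactnSr !expnSr mulnACA [leqRHS]mulnACA leq_mul //.
by rewrite mulnBl mulnBr leq_sub2l // mulnC leq_mul2l cM orbT.
Qed.

Lemma nb_lists_prod (C : 'I_n -> {set 'I_m.+1}) :
  nb_lists k (fun L : lists => [forall v, L v \subset C v]) = \prod_v 'C(#|C v|, k).
Proof.
have := card_family (fun v : 'I_n => [pred S : {set 'I_m.+1} | (S \subset C v) && (#|S| == k)]).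
rewrite foldrE big_map big_enum /= => E.
under eq_bigr => v _ do rewrite -cards_draws.
rewrite [RHS](eq_bigr (fun v => #|[pred S : {set 'I_m.+1} | (S \subset C v) && (#|S| == k)]|)).
  rewrite -E; apply: eq_card => L; rewrite !inE; apply/andP/familyP.
    by case=> /forallP kL /forallP LC v; rewrite !inE LC kL.
  by move=> H; split; apply/forallP => v; have := H v; rewrite !inE => /andP[].
by move=> v _; apply: eq_card => S; rewrite !inE.
Qed.

Lemma nb_lists_subset (K : {set 'I_n}) (C : {set 'I_m.+1}) :
  nb_lists k (fun L : lists => [forall v in K, L v \subset C]) * m.+1 ^ (k * #|K|)
  <= #|C| ^ (k * #|K|) * nb_lists k (fun L : lists => true).
Proof.
have -> : nb_lists k (fun L : lists => [forall v in K, L v \subset C]) =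
  \prod_v 'C(#|if v \in K then C else [set: 'I_m.+1]|, k).
  rewrite -nb_lists_prod; apply: eq_card => L; rewrite !inE; congr (_ && _).
  by apply: eq_forallb => v; case: ifP => //; rewrite finset.subsetT.
have -> : nb_lists k (fun L : lists => true) = \prod_(v < n) 'C(#|[set: 'I_m.+1]|, k).
  rewrite -nb_lists_prod; apply: eq_card => L; rewrite !inE; congr (_ && _).
  by apply/esym/forallP => v; rewrite finset.subsetT.
rewrite (bigID (mem K)) [\prod_(_ < _) 'C(_, _)](bigID (mem K)) /=.
rewrite mulnAC [leqRHS]mulnA leq_mul //; last first.
  by apply: leq_prod => v /negbTE ->.
rewrite (eq_bigr (fun=> 'C(#|C|, k))) => [|v ->//].
rewrite !prod_nat_const !expnM -!expnMn cardsT card_ord.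
have [->|K0] := posnP #|K|; first by rewrite !expn0.
rewrite leq_exp2r // bin_ratio_le //.
by rewrite -[X in _ <= X](card_ord m.+1) max_card.
Qed.

(** Union bound over the [m.+1 ^ j] maps from ['I_j] to the colours: any set of at most [j] colours
    lies in the image of one of them. *)
Lemma nb_lists_few_colours (K : {set 'I_n}) (j : nat) :
  nb_lists k (fun L : lists => #|\bigcup_(v in K) L v| <= j) * m.+1 ^ (k * #|K|)
  <= m.+1 ^ j * j ^ (k * #|K|) * nb_lists k (fun L : lists => true).
Proof.
pose P (f : {ffun 'I_j -> 'I_m.+1}) (L : lists) :=
  [forall v in K, L v \subset [set f i | i : 'I_j]].
apply: (@leq_trans ((\sum_(f : {ffun 'I_j -> 'I_m.+1}) nb_lists k (P f)) * m.+1 ^ (k * #|K|))).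
  rewrite leq_mul2r; apply/orP; right.
  apply: leq_trans (nb_lists_has _ _ _); apply: nb_listsS => L _ cj.
  pose C := \bigcup_(v in K) L v.
  (* The default [ord0] pads the enumeration when fewer than [j] colours occur; inclusion in the
     image is all that is needed. *)
  apply/hasP; exists [ffun i : 'I_j => nth ord0 (enum C) i]; rewrite ?mem_index_enum //.
  apply/forall_inP => v vK; apply/fintype.subsetP => c cL.
  have cC : c \in enum C by rewrite mem_enum; apply/finset.bigcupP; exists v.
  have ij : index c (enum C) < j by apply: leq_trans cj; rewrite cardE index_mem.
  by apply/imsetP; exists (Ordinal ij); rewrite // ffunE nth_index.
rewrite big_distrl /=.
apply: (@leq_trans (\sum_(f : {ffun 'I_j -> 'I_m.+1})
   j ^ (k * #|K|) * nb_lists k (fun L : lists => true))).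
  apply: leq_sum => f _; apply: leq_trans (nb_lists_subset _ _) _.
  rewrite leq_mul2r; apply/orP; right.
  have [->|K0] := posnP (k * #|K|); first by rewrite !expn0.
  by rewrite leq_exp2r // -[X in _ <= X]card_ord leq_imset_card.
by rewrite sum_nat_const card_ffun !card_ord mulnA.
Qed.

End FewColours.

(** * Minimal non-colourable sets *)

Section CriticalSets.
Variables (n m k : nat) (adj : rel 'I_n).
Hypotheses (adj_sym : symmetric adj) (adj_irr : irreflexive adj).
Notation lists := {ffun 'I_n -> {set 'I_m.+1}}.
Implicit Types (L : lists) (A K U : {set 'I_n}).

Definition colours_on L K (c : 'I_n -> 'I_m.+1) : bool :=
  [forall v in K, c v \in L v] &&
  [forall u in K, forall v in K, adj u v ==> (c u != c v)].

Lemma colours_onP L K (c : 'I_n -> 'I_m.+1) :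
  reflect ({in K, forall v, c v \in L v} /\ {in K &, forall u v, adj u v -> c u != c v})
          (colours_on L K c).
Proof.
apply: (iffP andP) => -[cL cA]; split.
- by move=> v; apply: (forall_inP cL).
- by move=> u v uK vK; apply/implyP; apply: (forall_inP (forall_inP cA u uK)).
- by apply/forall_inP.
- by apply/forall_inP => u uK; apply/forall_inP => v vK; apply/implyP; apply: cA.
Qed.

Definition colourable_on L K : bool :=
  [exists c : {ffun 'I_n -> 'I_m.+1}, colours_on L K c].

Lemma colourable_onI L K (c : 'I_n -> 'I_m.+1) : colours_on L K c -> colourable_on L K.
Proof.
move=> /colours_onP[cL cA]; apply/existsP; exists [ffun v => c v].
apply/colours_onP; split=> [v vK|u v uK vK uv]; rewrite !ffunE; [exact: cL|exact: cA].
Qed.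

Lemma colourable_onT L : colourable_on L [set: 'I_n] -> km_colourable adj L.
Proof.
case/existsP => c /colours_onP[cL cA]; apply/existsP; exists c; apply/andP; split.
  by apply/forallP => v; apply: cL.
by apply/forallP => u; apply/forallP => v; apply/implyP; apply: cA.
Qed.

Definition critical L := minset (fun K => ~~ colourable_on L K).

Lemma critical_exists L : ~~ km_colourable adj L -> exists K, critical L K.
Proof.
move=> nL; have [|K cK _] := @minset_exists _ (fun K => ~~ colourable_on L K) [set: 'I_n].
  by apply: contra nL; apply: colourable_onT.
by exists K.
Qed.

Section Critical.
Variables (L : lists) (K : {set 'I_n}).
Hypothesis critK : critical L K.

Lemma critical_neg : ~~ colourable_on L K. Proof. by have [] := minsetP critK. Qed.

Lemma critical_proper A : A \proper K -> colourable_on L A.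
Proof.
move=> /andP[AK KA]; apply: contraNT KA => nA.
by have [_ /(_ A nA AK) ->] := minsetP critK.
Qed.

Lemma critical_neq0 : K != finset.set0.
Proof.
apply: contraNneq critical_neg => ->.
apply: (@colourable_onI _ _ (fun=> ord0)).
by apply/colours_onP; split=> [v|u v]; rewrite inE.
Qed.

(* Otherwise colourings of [A] and of [K :\: A] could be glued together. *)
Lemma critical_conflict A : A \proper K -> A != finset.set0 ->
  exists u w, [/\ u \in A, w \in K :\: A, adj u w & conflict L u w].
Proof.
move=> AK /set0Pn[a aA]; have sAK := proper_sub AK.
have DK : K :\: A \proper K.
  rewrite properE subsetDl /=; apply/subsetPn; exists a; last by rewrite inE aA.
  exact: (fintype.subsetP sAK).
have /existsP[c1 /colours_onP[c1L c1A]] := critical_proper AK.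
have /existsP[c2 /colours_onP[c2L c2A]] := critical_proper DK.
case: (boolP [exists u in A, exists w in K :\: A, adj u w && conflict L u w]).
  by case/exists_inP => u uA /exists_inP[w wA /andP[uw cuw]]; exists u, w.
move=> nE; have nC u w : u \in A -> w \in K :\: A -> adj u w -> c1 u != c2 w.
  move=> uA wA uw; apply/eqP => cE.
  case/negP: nE; apply/exists_inP; exists u => //; apply/exists_inP; exists w => //.
  by rewrite uw; apply/pred0Pn; exists (c1 u); rewrite /= c1L // cE c2L.
case/negP: critical_neg.
apply: (@colourable_onI _ _ (fun v => if v \in A then c1 v else c2 v)).
apply/colours_onP; split=> [v vK|u v uK vK uv].
  by case: ifP => vA; [apply: c1L|apply: c2L; rewrite inE vA].
case: ifP => uA; case: ifP => vA.
- exact: c1A.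
- by apply: nC; rewrite // inE vA.
- by rewrite eq_sym; apply: nC; rewrite ?inE ?uA // adj_sym.
- by apply: c2A; rewrite ?inE ?uA ?vA.
Qed.

(** If [c] occurred in no other list of [K], a colouring of [K :\ v] would never use it and would
    extend by giving [c] to [v]. *)
Lemma critical_shared v c : v \in K -> c \in L v ->
  exists2 u, u \in K & (u != v) && (c \in L u).
Proof.
move=> vK cv; have vKK : K :\ v \proper K by apply: properD1.
have /existsP[d /colours_onP[dL dA]] := critical_proper vKK.
case: (boolP [exists u in K, (u != v) && (c \in L u)]); first by move=> /exists_inP.
move=> nE; case/negP: critical_neg.
have nd u : u \in K -> u != v -> d u != c.
  move=> uK uv; apply: contraNneq nE => du; apply/exists_inP; exists u => //.
  by rewrite uv -du dL // !inE uv.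
apply: (@colourable_onI _ _ (fun u => if u == v then c else d u)).
apply/colours_onP; split=> [u uK|u w uK wK uw].
  by have [->//|uv] := eqVneq u v; apply: dL; rewrite !inE uv.
have [uE|uv] := eqVneq u v; have [wE|wv] := eqVneq w v.
- by rewrite uE wE adj_irr in uw.
- by rewrite eq_sym nd.
- exact: nd.
- by apply: dA; rewrite // !inE ?uv ?wv.
Qed.

(** There are [k * #|K|] pairs of a vertex of [K] and a colour of its list, and each colour accounts
    for at least two. *)
Lemma critical_few_colours : is_km_assignment k L ->
  #|\bigcup_(v in K) L v| <= (k * #|K|)./2.
Proof.
move=> /forallP kL; rewrite geq_half_double -muln2.
rewrite -sum_nat_const [leqRHS]mulnC -sum_nat_const.
rewrite [leqRHS](eq_bigr (fun v => #|L v|)) => [|v _]; last by rewrite (eqP (kL v)).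
under [leqRHS]eq_bigr => v _ do rewrite -sum1_card.
rewrite (exchange_big_dep (mem (\bigcup_(v in K) L v))) /=; last first.
  by move=> v c vK cv; apply/finset.bigcupP; exists v.
apply: leq_sum => c /finset.bigcupP[v vK cv].
have [u uK /andP[uv cu]] := critical_shared vK cv.
by rewrite (bigD1 v) /= ?vK ?cv // (bigD1 u) /= ?uK ?cu //.
Qed.

(** Invariant: a seen vertex that has left the queue has no conflict edge to [K :\: U]. Each step
    takes as [A] all unseen conflict neighbours in [K], so by [critical_conflict] the queue is empty
    only when [U = K]. Since [#|U| - size Q] vertices are processed, [t] more steps are
    available. *)
Lemma critical_explore_from t U Q : U \subset K -> U != finset.set0 ->
  {in U, forall u, u \notin Q -> {in K :\: U, forall w, ~~ (adj u w && conflict L u w)}} ->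
  {subset Q <= U} ->
  t + #|U| <= #|K| + size Q -> explore adj t U Q L.
Proof.
elim: t U Q => [//|t IH] U [|q Q] UK U0 ex QU; rewrite /= => tU.
  have [UeK|UK'] := eqVneq U K.
    by move: tU; rewrite UeK addn0 addSn ltnNge leq_addl.
  have [|u [w [uU wK uw cuw]]] := @critical_conflict U _ U0.
    by rewrite finset.properEneq UK' UK.
  by have := ex u uU isT w wK; rewrite uw cuw.
apply/existsP; exists [set a in K :\: U | adj q a && conflict L q a].
set A := [set _ in _ | _].
apply/and3P; split.
- by apply/fintype.subsetP => a; rewrite !inE => /andP[/andP[-> _] /andP[-> _]].
- by apply/forall_inP => a; rewrite inE => /and3P[].
have AU : [disjoint A & U].
  rewrite finset.disjoints_subset; apply/fintype.subsetP => a; rewrite !inE.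
  by case/andP=> /andP[].
apply: IH.
- rewrite finset.subUset UK; apply/fintype.subsetP => a; rewrite !inE.
  by case/andP=> /andP[].
- by case/set0Pn: U0 => u uU; apply/set0Pn; exists u; rewrite inE uU.
- move=> u; rewrite finset.in_setU mem_cat mem_enum negb_or => uUA /andP[uQ uA] w.
  rewrite finset.in_setD finset.in_setU negb_or => /andP[/andP[wU wA] wK].
  have {}uU : u \in U by move: uUA; rewrite (negbTE uA) orbF.
  have wKU : w \in K :\: U by rewrite inE wU.
  have [uq|uq] := eqVneq u q; last by apply: ex => //; rewrite inE negb_or uq.
  by rewrite uq; apply: contra wA => cqw; rewrite !inE wU wK cqw.
- move=> u; rewrite mem_cat mem_enum finset.in_setU => /orP[uQ|->]; last by rewrite orbT.
  by rewrite QU // inE uQ orbT.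
- rewrite cardsU (_ : U :&: A = finset.set0) ?cards0 ?subn0; last first.
    by apply/eqP; rewrite setI_eq0 disjoint_sym.
  by rewrite size_cat -cardE !addnA leq_add2r; move: tU; rewrite addSn addnS ltnS.
Qed.

Lemma critical_explore t : t <= #|K| -> exists v, explore adj t [set v] [:: v] L.
Proof.
move=> tK; have /set0Pn[v vK] := critical_neq0; exists v.
apply: critical_explore_from.
- by rewrite finset.sub1set.
- by apply/set0Pn; exists v; rewrite inE.
- by move=> u; rewrite !inE => ->.
- by move=> u; rewrite !inE.
- by rewrite cards1 leq_add2r.
Qed.

End Critical.

(** The head is the newest vertex, adjacent to an earlier one. Adjacency is that of [adj], not of
    the conflict graph, so the family does not depend on the lists and a union bound applies. *)
Fixpoint connected_seqs (s : nat) : seq (seq 'I_n) :=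
  if s is s'.+1 then
    [seq u :: w | w <- connected_seqs s',
                  u <- enum [set u | (u \notin w) && has (adj^~ u) w]]
  else [seq [:: v] | v <- enum 'I_n].

Lemma connected_seqsP s w : w \in connected_seqs s -> uniq w /\ size w = s.+1.
Proof.
elim: s w => [|s IH] w /=; first by case/mapP => v _ ->.
case/allpairsPdep => w' [u [/IH[uw sw]]]; rewrite mem_enum inE => /andP[uw' _] ->.
by rewrite /= uw' uw sw.
Qed.

(** A sequence of [s.+1] vertices has at most [s.+1 * D] extensions; the product of these counts is
    at most a power. *)
Lemma size_connected_seqs D s : (forall q, #|[set u | adj q u]| <= D) ->
  size (connected_seqs s) <= n * (s * D) ^ s.
Proof.
move=> dD; elim: s => [|s IH]; first by rewrite /= size_map -cardE card_ord expn0 muln1.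
rewrite [connected_seqs _]/= size_allpairs_dep sumnE big_map.
apply: (@leq_trans (\sum_(w <- connected_seqs s) s.+1 * D)).
  rewrite big_seq [leqRHS]big_seq; apply: leq_sum => w /connected_seqsP[_ sw].
  rewrite -cardE -sw.
  have H : #|[set u | has (adj^~ u) w]| <= size w * D.
    elim: w {sw} => [|v w IHw] /=.
      by rewrite leqn0 cards_eq0; apply/eqP/setP => u; rewrite !inE.
    rewrite mulSn; apply: leq_trans (leq_add (dD v) IHw).
    apply: leq_trans (leq_card_setU _ _); apply/subset_leq_card/fintype.subsetP => u.
    by rewrite !inE.
  by apply: leq_trans H; apply/subset_leq_card/fintype.subsetP => u; rewrite !inE => /andP[].
rewrite big_const_seq count_predT iter_addn_0 [leqLHS]mulnC expnSr [leqRHS]mulnA leq_mul2r; apply/orP; right.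
apply: leq_trans IH _; rewrite leq_mul2l; apply/orP; right.
have [->|s0] := posnP s; first by rewrite !expn0.
by rewrite leq_exp2r // leq_mul2r leqnSn orbT.
Qed.

Lemma critical_connected_seq L K s : critical L K -> s < #|K| ->
  exists2 w, w \in connected_seqs s & [set v in w] \subset K.
Proof.
move=> cK; elim: s => [_|s IH sK].
  have /set0Pn[v vK] := critical_neq0 cK.
  exists [:: v]; first by apply: map_f; rewrite mem_enum.
  by apply/fintype.subsetP => u; rewrite !inE => /eqP ->.
have [w ws wK] := IH (ltnW sK).
have [uw sw] := connected_seqsP ws.
have cw : #|[set v in w]| = s.+1.
  by rewrite cardsE; rewrite -sw; apply/card_uniqP.
have [||u [x [uW xK ux _]]] := @critical_conflict _ _ cK [set v in w].
- rewrite properE wK; apply: contraTN sK => /subset_leq_card; rewrite cw -leqNgt //.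
- by rewrite -card_gt0 cw.
move: xK; rewrite !inE => /andP[xw xK]; rewrite inE in uW.
exists (x :: w).
  apply/allpairsPdep; exists w, x; split => //.
  by rewrite mem_enum inE xw; apply/hasP; exists u.
apply/fintype.subsetP => y; rewrite !inE => /orP[/eqP->//|yw].
by apply: (fintype.subsetP wK); rewrite inE.
Qed.

(** Otherwise the subgraph induced on [K], transported to ['I_#|K|], would be [k]-choosable, hence
    [K] colourable. *)
Lemma critical_size HF g L K : small_choosable HF k g -> Hfree HF adj ->
  is_km_assignment k L -> critical L K -> g < #|K|.
Proof.
move=> sc hf /forallP kL cK; rewrite ltnNge; apply/negP => Kg.
have /set0Pn[v0 v0K] := critical_neq0 cK.
pose f (i : 'I_#|K|) : 'I_n := enum_val i.
have fK i : f i \in K by apply: enum_valP.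
have [||||c [cL cA]] := @sc #|K| (fun i j => adj (f i) (f j)) Kg _ _ _
    (fun i => [seq val c | c <- enum (L (f i))]).
- by move=> i j; apply: adj_sym.
- by move=> i; apply: adj_irr.
- move=> H HFH [h [hi hA]]; apply: (hf H HFH); exists (f \o h); split => //.
  by apply: inj_comp => //; apply: enum_val_inj.
- move=> i; split; last by rewrite size_map -cardE; apply/eqP.
  by rewrite map_inj_uniq ?enum_uniq //; apply: val_inj.
case/negP: (critical_neg cK).
pose r v := enum_rank_in v0K v.
have fr : {in K, cancel r f} by move=> v vK; apply: enum_rankK_in.
have valc v : v \in K -> exists2 d, d \in L v & c (r v) = val d.
  move=> vK; have := cL (r v); rewrite fr // => /mapP[d].
  by rewrite mem_enum => dL ->; exists d.
have inordc v : v \in K -> val (inord (c (r v)) : 'I_m.+1) = c (r v).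
  by case/valc => d dL ->; rewrite inord_val.
(* [inord] loses nothing here: a colour taken from a list is below [m.+1]. *)
apply: (@colourable_onI _ _ (fun v => inord (c (r v)))).
apply/colours_onP; split=> [v vK|u v uK vK uv].
  by have [d dL ->] := valc v vK; rewrite inord_val.
apply/eqP => /(congr1 val); rewrite !inordc //; apply: cA.
by rewrite !fr.
Qed.

End CriticalSets.

(** * Numerical bounds for the two regimes *)

Section Bounds.
Variable (R : realType).
Local Open Scope ring_scope.

(** From [exp(-1/8) >= 7/8] follows [e <= (8/7)^8]. The value 2.94 is 3 times the rate 0.98 used
    below. *)
Lemma expR1_le : expR (1 : R) <= 294%:R / 100%:R.
Proof.
have h : expR (8%:R^-1 : R) <= 8%:R / 7%:R.
  rewrite -[8%:R^-1]opprK expRN -[leRHS]invrK lef_pV2 ?posrE ?expR_gt0 ?invr_gt0 ?divr_gt0 //.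
  by apply: le_trans (expR_ge1Dx _); rewrite invf_div; lra.
have -> : (1 : R) = 8%:R * 8%:R^-1 by rewrite divff.
rewrite expRM_natl.
apply: (@le_trans _ _ ((8%:R / 7%:R) ^+ 8)); last by lra.
by rewrite lerXn2r // nnegrE ?expR_ge0 // divr_ge0.
Qed.

Lemma exploration_rate_le (x : R) (D : nat) : 0 <= x -> 3 * x * D%:R <= 1 ->
  (1 + 3 * x) ^+ D / 3 <= 98%:R / 100%:R.
Proof.
move=> x0 xD; rewrite ler_pdivrMr //.
apply: (@le_trans _ _ (expR (3 * x) ^+ D)).
  by rewrite lerXn2r ?nnegrE ?expR_ge0 ?expR_ge1Dx // addr_ge0 // mulr_ge0.
rewrite -expRM_natr; apply: (@le_trans _ _ (expR 1)); first by rewrite ler_expR.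
by apply: le_trans expR1_le _; lra.
Qed.

(** Working with the square root of [m.+1] removes the parity of [k * #|K|] from the exponents. *)
Lemma nb_lists_few_colours_sqrt n m k (K : {set 'I_n}) :
  (nb_lists k (fun L : {ffun 'I_n -> {set 'I_m.+1}} =>
     #|\bigcup_(v in K) L v| <= (k * #|K|)./2)%N)%:R
  <= (k * #|K|)%:R ^+ (k * #|K|) / Num.sqrt m.+1%:R ^+ (k * #|K|) *
     (nb_lists k (fun L : {ffun 'I_n -> {set 'I_m.+1}} => true))%:R :> R.
Proof.
set e := (k * #|K|)%N; set N := nb_lists k (fun=> true); set B := nb_lists _ _; set mu := Num.sqrt _.
have := nb_lists_few_colours m k K e./2; rewrite -/e -/B -/N => H.
have mu2 : mu ^+ 2 = m.+1%:R by rewrite sqr_sqrtr.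
have mu1 : 1 <= mu by rewrite -sqrtr1 ler_sqrt // ler1n.
have mu0 : 0 < mu by apply: lt_le_trans mu1.
have {}H : B%:R * (mu ^+ e * mu ^+ e) <= mu ^+ e * (e%:R ^+ e * N%:R) :> R.
  apply: (@le_trans _ _ ((m.+1 ^ e./2 * e./2 ^ e * N)%N%:R)).
    by rewrite -exprD addnn -mul2n exprM mu2 -natrX -natrM ler_nat.
  rewrite -!natrX !natrM -mulrA natrX -mu2 -exprM mul2n natrX.
  have he : (e./2.*2 <= e)%N by rewrite -[leqRHS]odd_double_half leq_addl.
  apply: ler_pM; rewrite ?mulr_ge0 ?exprn_ge0 // ?(ltW mu0) //.
    by apply: ler_weXn2l.
  rewrite natrX ler_wpM2r // lerXn2r ?nnegrE // ler_nat.
  by apply: leq_trans he; rewrite -addnn leq_addr.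
rewrite mulrAC ler_pdivlMr ?exprn_gt0 //.
move: H; rewrite mulrA [leRHS]mulrC ler_pM2r ?exprn_gt0 //.
Qed.

End Bounds.

(** * Union bound for non-colourability *)

Section UnionBound.
Variables (R : realType) (n m k : nat) (adj : rel 'I_n) (HF : sgraph -> Prop) (g : nat).
Hypotheses (adj_sym : symmetric adj) (adj_irr : irreflexive adj).
Hypotheses (adj_free : Hfree HF adj) (small : small_choosable HF k g).
Notation lists := {ffun 'I_n -> {set 'I_m.+1}}.
Notation D := (maxdeg adj).

Lemma degree_le_maxdeg q : #|[set u | adj q u]| <= D.
Proof. exact: (@leq_bigmax _ (fun v : 'I_n => #|[set u | adj v u]|) q). Qed.

Lemma not_colourable_cases S (L : lists) : is_km_assignment k L -> ~~ km_colourable adj L ->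
  has (fun s => has (fun w : seq 'I_n => #|\bigcup_(v in [set v in w]) L v| <= (k * s.+1)./2)
     (connected_seqs adj s)) (index_iota g S)
  || has (fun v => explore adj S [set v] [:: v] L) (enum 'I_n).
Proof.
move=> kL /critical_exists[K cK].
have [KS|SK] := leqP #|K| S; last first.
  have [v ev] := critical_explore adj_sym cK (ltnW SK).
  by apply/orP; right; apply/hasP; exists v; rewrite ?mem_enum.
apply/orP; left.
have gK := critical_size adj_sym adj_irr small adj_free kL cK.
case cardK: #|K| gK KS => [//|s] gs sS.
have [w ws wK] := @critical_connected_seq _ _ _ adj_sym L K s cK (eq_leq (esym cardK)).
have [uw sw] := connected_seqsP ws.
(* The sequence has as many vertices as [K], so it exhausts [K] and inherits its colour bound. *)
have wKE : [set v in w] = K.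
  by apply/eqP; rewrite eqEcard wK cardK cardsE -sw; apply/eq_leq/esym/card_uniqP.
apply/hasP; exists s; first by rewrite mem_index_iota -ltnS gs.
by apply/hasP; exists w; rewrite // wKE -cardK (critical_few_colours adj_irr cK kL).
Qed.

Lemma nb_not_colourable_le S : (3 * k ^ 2 * D <= m.+1)%N ->
  ((nb_lists k (fun L : lists => ~~ km_colourable adj L))%:R <=
   (\sum_(g <= s < S) (n * (s * D) ^ s)%:R *
      ((k * s.+1)%:R ^+ (k * s.+1) / Num.sqrt m.+1%:R ^+ (k * s.+1))
    + n%:R * 3 * (98%:R / 100%:R) ^+ S) *
   (nb_lists k (fun L : lists => true))%:R :> R)%R.
Proof.
move=> mD; set N := nb_lists k (fun=> true).
pose P1 (L : lists) := has (fun s => has (fun w : seq 'I_n =>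
   #|\bigcup_(v in [set v in w]) L v| <= (k * s.+1)./2)
     (connected_seqs adj s)) (index_iota g S).
pose P2 (L : lists) := has (fun v => explore adj S [set v] [:: v] L) (enum 'I_n).
apply: (@le_trans _ _ (nb_lists k P1 + nb_lists k P2)%N%:R%R).
  rewrite ler_nat; have := @nb_lists_has n m k _ [:: P1; P2] id.
  rewrite big_cons big_seq1; apply: leq_trans; apply: nb_listsS => L kL nL /=.
  by rewrite orbF; exact: not_colourable_cases.
rewrite natrD mulrDl lerD //.
  apply: (@le_trans _ _ (\sum_(g <= s < S) \sum_(w <- connected_seqs adj s)
     nb_lists k (fun L : lists => #|\bigcup_(v in [set v in w]) L v| <= (k * s.+1)./2))%N%:R%R).
    rewrite ler_nat; apply: leq_trans (nb_lists_has _ _ _) _.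
    by apply: leq_sum => s _; apply: nb_lists_has.
  rewrite natr_sum mulr_suml; apply: ler_sum => s _.
  rewrite natr_sum; set c : R := (_ / _)%R.
  have c0 : (0 <= c)%R by rewrite divr_ge0 // exprn_ge0 // sqrtr_ge0.
  apply: (@le_trans _ _ (\sum_(w <- connected_seqs adj s) c * N%:R)%R).
    rewrite big_seq [leRHS]big_seq; apply: ler_sum => w /connected_seqsP[uw sw].
    have cw : #|[set v in w]| = s.+1 by rewrite cardsE -sw; apply/card_uniqP.
    by have := @nb_lists_few_colours_sqrt R n m k [set v in w]; rewrite cw.
  rewrite big_const_seq count_predT iter_addr_0 -[leLHS]mulr_natl mulrA.
  rewrite ler_wpM2r // ler_wpM2r // ler_nat size_connected_seqs //.
  exact: degree_le_maxdeg.
apply: (@le_trans _ _ (\sum_(v <- enum 'I_n)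
    nb_lists k (fun L : lists => true && explore adj S [set v] [:: v] L))%N%:R%R).
  by rewrite ler_nat; apply: nb_lists_has.
rewrite natr_sum.
apply: (@le_trans _ _ (\sum_(v <- enum 'I_n) 3 * (98%:R / 100%:R) ^+ S * N%:R)%R).
  apply: ler_sum => v _.
  apply: le_trans (@nb_lists_explore n m k adj R D degree_le_maxdeg S [set v] [:: v] (fun=> true) _ _) _.
  - by [].
  - by move=> u; rewrite !inE.
  rewrite expr1 ler_wpM2r // ler_wpM2l //.
  set rho := ((1 + _) ^+ D / 3)%R.
  have x0 : (0 <= (k ^ 2)%:R / m.+1%:R :> R)%R by rewrite divr_ge0.
  rewrite lerXn2r ?nnegrE //; first by rewrite divr_ge0 // exprn_ge0 // addr_ge0 // mulr_ge0.
  apply: exploration_rate_le => //.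
  rewrite mulrA mulrAC ler_pdivrMr ?ltr0n // mul1r.
  by rewrite -!natrM ler_nat.
by rewrite big_const_seq count_predT iter_addr_0 -cardE card_ord -[leLHS]mulr_natl !mulrA.
Qed.

End UnionBound.

Lemma prob_ge (R : realType) (n m k g S : nat) (adj : rel 'I_n) (HF : sgraph -> Prop) :
  symmetric adj -> irreflexive adj -> Hfree HF adj -> small_choosable HF k g ->
  0 < m -> k <= m -> 3 * k ^ 2 * maxdeg adj <= m ->
  (`|1 - prob_km_colourable R k m adj| <=
   \sum_(g <= s < S) (n * (s * maxdeg adj) ^ s)%:R *
      ((k * s.+1)%:R ^+ (k * s.+1) / Num.sqrt m%:R ^+ (k * s.+1))
    + n%:R * 3 * (98%:R / 100%:R) ^+ S :> R)%R.
Proof.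
move=> adj_sym adj_irr free small; case: m => // m _ km mD.
set N := nb_lists k (fun L : {ffun 'I_n -> {set 'I_m.+1}} => true).
have NE : #|[set L : {ffun 'I_n -> {set 'I_m.+1}} | is_km_assignment k L]| = N.
  by apply: eq_card => L; rewrite !inE andbT.
(* [k <= m] provides a [k]-subset of the colours, so the denominator is nonzero. *)
have N0 : 0 < N.
  rewrite -NE card_gt0; apply/set0Pn.
  have : 0 < #|[set A : {set 'I_m.+1} | #|A| == k]| by rewrite card_draws card_ord bin_gt0.
  case/card_gt0P => A; rewrite inE => kA.
  by exists [ffun=> A]; rewrite inE; apply/forallP => v; rewrite ffunE.
have splitN : N = nb_lists k (fun L : {ffun 'I_n -> {set 'I_m.+1}} => km_colourable adj L)
   + nb_lists k (fun L : {ffun 'I_n -> {set 'I_m.+1}} => ~~ km_colourable adj L).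
  rewrite -NE -(cardsID [set L | km_colourable adj L]); congr addn.
    by apply: eq_card => L; rewrite !inE.
  by apply: eq_card => L; rewrite !inE andbC.
rewrite /prob_km_colourable NE -/(nb_lists k (km_colourable adj)).
set b := nb_lists k (fun L => ~~ _) in splitN; set a := nb_lists k _ in splitN *.
have -> : (1 - a%:R / N%:R = b%:R / N%:R :> R)%R.
  apply/eqP; rewrite subr_eq -mulrDl -natrD addnC -splitN divff //.
  by rewrite pnatr_eq0 -lt0n.
rewrite ger0_norm ?divr_ge0 // ler_pdivrMr ?ltr0n //.
exact: (nb_not_colourable_le R adj_sym adj_irr free small S mD).
Qed.

(** * Asymptotic estimates *)

Section Asymptotics.
Variable R : realType.
Local Open Scope ring_scope.

(** All factors depending only on [s] and [k] are absorbed into [p ^ s.+1]. *)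
Lemma term_le (n D k s p : nat) (mu : R) : 0 < mu -> (s.+1 * (k * s.+1) ^ k <= p)%N ->
  (n * (s * D) ^ s)%:R * ((k * s.+1)%:R ^+ (k * s.+1) / mu ^+ (k * s.+1))
  <= n%:R * D%:R ^+ s * p%:R ^+ s.+1 / mu ^+ (k * s.+1).
Proof.
move=> mu0 sp; rewrite mulrA ler_pM2r ?invr_gt0 ?exprn_gt0 //.
rewrite -!natrX -!natrM ler_nat -!mulnA leq_mul2l; apply/orP; right.
apply: (@leq_trans (D ^ s * (s.+1 * (k * s.+1) ^ k) ^ s.+1)%N); last first.
  by rewrite leq_mul2l leq_exp2r // sp orbT.
rewrite (expnMn s D) (expnMn s.+1 ((k * s.+1) ^ k)) -expnM mulnA leq_mul2r.
apply/orP; right; rewrite mulnC leq_mul2l; apply/orP; right.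
apply: (@leq_trans (s.+1 ^ s)); last by rewrite leq_pexp2l.
by case: s {sp} => // s; rewrite leq_exp2r.
Qed.

(* The term [s = g] dominates: each further vertex costs a factor
   [D * p / mu ^ k <= p / mu], which is small since [D <= mu ^ 2] and [k >= 3]. *)
Lemma sum_terms_le (n D k g S : nat) (mu : R) : (3 <= k)%N -> 1 <= mu -> D%:R <= mu ^+ 2 ->
  D = 0%N \/ (S * (S * (k * S) ^ k) ^ g.+2)%:R <= mu ->
  \sum_(g <= s < S) (n * (s * D) ^ s)%:R *
      ((k * s.+1)%:R ^+ (k * s.+1) / mu ^+ (k * s.+1))
  <= n%:R * D%:R ^+ g / mu ^+ (k * g.+1) * ((g.+1 * (k * g.+1) ^ k)%:R ^+ g.+1 + 1).
Proof.
move=> k3 mu1 Dmu HS; have mu0 : 0 < mu by apply: lt_le_trans mu1.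
set X := n%:R * _ / _.
have X0 : 0 <= X by rewrite divr_ge0 ?mulr_ge0 ?exprn_ge0 // ltW.
have [Sg|gS] := leqP S g.
  by rewrite big_geq // mulr_ge0 // addr_ge0 // exprn_ge0.
rewrite big_ltn // mulrDr; apply: lerD.
  apply: le_trans (term_le _ _ mu0 (leqnn _)) _.
  by rewrite /X mulrAC.
rewrite mulr1; case: HS => [D0|pmu].
  (* With [D = 0] every term with [s > g] vanishes. *)
  rewrite big_nat_cond big1 // => s /andP[/andP[gs _] _].
  by rewrite D0 muln0 exp0n ?muln0 ?mul0r // (leq_ltn_trans _ gs).
(* This [p] serves in [term_le] for all [s < S] at once. *)
set p := (S * (k * S) ^ k)%N in pmu.
have S0 : (0 < S)%N by apply: leq_ltn_trans gS.
have p0 : (0 < p)%N by rewrite muln_gt0 S0 expn_gt0 muln_gt0 S0 (leq_trans _ k3).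
have {}pmu : S%:R * p%:R ^+ g.+2 <= mu by rewrite -natrX -natrM.
have p1mu : p%:R / mu <= 1.
  rewrite ler_pdivrMr // mul1r; apply: le_trans pmu.
  rewrite -natrX -natrM ler_nat; apply: (@leq_trans (p ^ g.+2)%N).
    by rewrite -{1}(expn1 p) leq_pexp2l.
  by rewrite leq_pmull.
have pmu0 : 0 <= p%:R / mu by rewrite divr_ge0 // ltW.
have step : D%:R * p%:R / mu ^+ k <= p%:R / mu.
  rewrite ler_pdivrMr ?exprn_gt0 // [leRHS]mulrAC ler_pdivlMr //.
  rewrite [leRHS]mulrC [D%:R * _]mulrC -!mulrA [leRHS]mulrC ler_wpM2l //.
  apply: (@le_trans _ _ (mu ^+ 2 * mu)); first by rewrite ler_wpM2r // ltW.
  by rewrite -exprSr ler_weXn2l.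
have one s : (g < s < S)%N -> (n * (s * D) ^ s)%:R *
      ((k * s.+1)%:R ^+ (k * s.+1) / mu ^+ (k * s.+1)) <= X * p%:R ^+ g.+1 * (p%:R / mu).
  case/andP=> gs sS.
  have sp : (s.+1 * (k * s.+1) ^ k <= p)%N.
    by rewrite leq_mul // leq_exp2r ?leq_mul2l ?sS ?orbT // (leq_trans _ k3).
  apply: le_trans (term_le _ _ mu0 sp) _.
  rewrite -(subnKC gs); set i := (s - g.+1)%N.
  have -> : n%:R * D%:R ^+ (g.+1 + i) * p%:R ^+ (g.+1 + i).+1 / mu ^+ (k * (g.+1 + i).+1)
      = X * p%:R ^+ g.+1 * (D%:R * p%:R / mu ^+ k) ^+ i.+1.
    rewrite /X !exprMn -exprVn -!exprVn -!exprM -addnS mulnDr addSnnS !exprD.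
    by rewrite [(k * i.+1)%N]mulnC mulnC exprM; ring.
  rewrite ler_wpM2l ?(mulr_ge0 X0) ?exprn_ge0 //.
  have D0 : 0 <= D%:R * p%:R / mu ^+ k by rewrite divr_ge0 ?mulr_ge0 ?exprn_ge0 // ltW.
  apply: (@le_trans _ _ ((p%:R / mu) ^+ i.+1)); first by rewrite lerXn2r.
  by rewrite exprS ler_piMr // exprn_ile1.
apply: (@le_trans _ _ (\sum_(g.+1 <= s < S) X * p%:R ^+ g.+1 * (p%:R / mu))).
  by rewrite big_nat_cond [leRHS]big_nat_cond; apply: ler_sum => s; rewrite andbT; exact: one.
rewrite big_const_nat iter_addr_0 -[leLHS]mulr_natr.
(* At most [S] terms remain, and [S * p ^ g.+2 <= mu] makes their sum at most [X]. *)
apply: (@le_trans _ _ (X * p%:R ^+ g.+1 * (p%:R / mu) * S%:R)).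
  by rewrite ler_wpM2l ?(mulr_ge0 (mulr_ge0 X0 _)) ?exprn_ge0 // ler_nat leq_subr.
clearbody X; rewrite -!mulrA ler_piMr // !mulrA -exprSr mulrAC ler_pdivrMr // mul1r.
by rewrite mulrC.
Qed.

(** The exponent is removed by setting [u = t %/ b], [b] being nonzero; then [C * (u + 1) <= 2 ^ u],
    obtained by comparing both with [(w + 1) ^ 2] for [w = u./2]. *)
Lemma poly_le_expn2 (a b : nat) : exists T, forall t, (T <= t)%N -> ((a * t.+1) ^ b <= 2 ^ t)%N.
Proof.
case: b => [|b]; first by exists 0%N => t _; rewrite expn0 expn_gt0.
pose C := (a * b.+1)%N.
exists (b.+1 * (4 * C).+1)%N => t Tt.
pose u := (t %/ b.+1)%N.
have ut : (u * b.+1 <= t)%N by apply: leq_trunc_div.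
have tu : (t < b.+1 * u.+1)%N by rewrite mulnC ltn_ceil.
have uC : (4 * C < u)%N by rewrite leq_divRL // mulnC.
apply: (@leq_trans ((2 ^ u) ^ b.+1)); last by rewrite -expnM leq_pexp2l.
rewrite leq_exp2r //; apply: (@leq_trans (C * u.+1)%N).
  by rewrite /C -mulnA leq_mul2l tu orbT.
have uE := odd_double_half u; set w := u./2 in uE.
have w2 : (w < 2 ^ w)%N by apply: ltn_expl.
apply: (@leq_trans (2 ^ w * 2 ^ w)%N); last by rewrite -expnD leq_pexp2l // addnn -uE leq_addl.
apply: (@leq_trans (w.+1 * w.+1)%N); last by rewrite leq_mul.
have b1 : (odd u <= 1)%N by case: odd.
nia.
Qed.

(** The [q]-th power clears the fractional exponents, and a square root then gives the claim; hence
    [M ^+ 2] in the hypothesis. *)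
Lemma ratio_bound (n D q g : nat) (M : R) (mm : nat) : (0 < q)%N -> 0 <= M ->
  (M ^+ 2) * ((n%:R : R) `^ (2%:R / q%:R) * (D%:R : R) `^ ((2 * g)%:R / q%:R)) <= mm%:R ->
  M ^+ q * (n%:R * D%:R ^+ g) <= Num.sqrt (mm%:R : R) ^+ q.
Proof.
move=> q0 M0 H.
have qR : (q%:R : R) != 0 by rewrite pnatr_eq0 -lt0n.
have pw (a i : nat) : ((a%:R : R) `^ (i%:R / q%:R)) ^+ q = a%:R ^+ i.
  by rewrite -powR_mulrn ?powR_ge0 // -powRrM divfK // powR_mulrn.
rewrite -(@ler_pXn2r _ 2) // ?nnegrE ?mulr_ge0 ?exprn_ge0 ?sqrtr_ge0 //.
have -> : (Num.sqrt (mm%:R : R) ^+ q) ^+ 2 = mm%:R ^+ q by rewrite exprAC sqr_sqrtr.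
have -> : (M ^+ q * (n%:R * D%:R ^+ g)) ^+ 2 = (M ^+ 2) ^+ q * (n%:R ^+ 2 * D%:R ^+ (2 * g)).
  by rewrite (exprMn _ (M ^+ q)) exprAC (exprMn _ n%:R) -(exprM _ g) [(g * 2)%N]mulnC.
have := @lerXn2r R q _ _ _ _ H; rewrite !nnegrE !mulr_ge0 ?exprn_ge0 ?powR_ge0 //.
by move=> /(_ isT (ler0n _ _)); rewrite (exprMn _ (M ^+ 2)) (exprMn _ (n%:R `^ _)) !pw.
Qed.

(** As [0.98 ^ 50 <= 1/2], the exponent [100 * t] with [2 ^ t > n] yields two factors [1/n], one of
    which cancels [n]. For [n = 0] both sides are 0. *)
Lemma geometric_tail_le (n : nat) :
  n%:R * 3 * (98%:R / 100%:R) ^+ (100 * (trunc_log 2 n).+1) <= 3 / n%:R :> R.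
Proof.
case: n => [|n]; first by rewrite !mul0r invr0 mulr0.
set t := (trunc_log 2 n.+1).+1.
have nt : (n.+1 < 2 ^ t)%N by apply: trunc_log_ltn.
have h : (98%:R / 100%:R : R) ^+ 50 <= 2^-1.
  apply: (@le_trans _ _ (expR (- 50%:R^-1) ^+ 50)).
    rewrite lerXn2r ?nnegrE ?expR_ge0 ?divr_ge0 //.
    by apply: le_trans (expR_ge1Dx _); lra.
  rewrite -expRM_natl mulrN divff // expRN lef_pV2 ?posrE ?expR_gt0 //.
  exact: le_trans (expR_ge1Dx _).
have h0 : 0 <= (98%:R / 100%:R : R) ^+ 50 by rewrite exprn_ge0 // divr_ge0.
have -> : (98%:R / 100%:R : R) ^+ (100 * t) = ((98%:R / 100%:R) ^+ 50) ^+ t * ((98%:R / 100%:R) ^+ 50) ^+ t.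
  by rewrite -exprD -exprM addnn -mul2n mulnA.
have nh : ((98%:R / 100%:R : R) ^+ 50) ^+ t <= n.+1%:R^-1.
  apply: (@le_trans _ _ (2^-1 ^+ t)); first by rewrite lerXn2r ?nnegrE.
  by rewrite exprVn lef_pV2 ?posrE ?exprn_gt0 ?ltr0n // -natrX ler_nat ltnW.
apply: (@le_trans _ _ (n.+1%:R * 3 * (n.+1%:R^-1 * n.+1%:R^-1))).
  by rewrite ler_wpM2l // ler_pM ?exprn_ge0.
rewrite [X in X <= _](_ : _ = 3 / n.+1%:R * (n.+1%:R / n.+1%:R)); last by ring.
by rewrite divff ?mulr1 // pnatr_eq0.
Qed.
End Asymptotics.

(** The base is polynomial in [log n]; the bound supplies the condition on [mu] in [sum_terms_le]
    after taking [q]-th roots. *)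
Lemma log_scale_le (k g : nat) : 0 < k -> exists T, forall n, 2 ^ T <= n ->
  (100 * (trunc_log 2 n).+1 * (100 * (trunc_log 2 n).+1 *
     (k * (100 * (trunc_log 2 n).+1)) ^ k) ^ g.+2) ^ (k * g.+1) <= n.
Proof.
move=> k0; have [T HT] := poly_le_expn2 (k * 100) ((k.+1 * g.+2).+1 * (k * g.+1)).
exists T => n nT; have n0 : 0 < n by apply: leq_trans nT; rewrite expn_gt0.
apply: leq_trans (trunc_logP (isT : 1 < 2) n0).
apply: leq_trans (HT _ (trunc_log_max _ nT)) => //.
rewrite -[k * 100 * _]mulnA; set S := (100 * _)%N.
have kS : S <= k * S by rewrite leq_pmull.
rewrite [leqRHS]expnM leq_exp2r ?muln_gt0 ?k0 // [leqRHS]expnS leq_mul //.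
by rewrite [leqRHS]expnM leq_exp2r // [leqRHS]expnS leq_mul.
Qed.

(** * Convergence of the probability to 1 *)

Local Open Scope classical_set_scope.
Local Open Scope ring_scope.

Theorem mainTheorem2 (R : realType) (k : nat) (Hk : (3 <= k)%N)
  (HF : sgraph -> Prop) (g : nat) (Hg : is_g HF k g)
  (G : forall n : nat, rel 'I_n)
  (Gsym : forall n, symmetric (G n)) (Girr : forall n, irreflexive (G n))
  (Gfree : forall n, Hfree HF (G n))
  (m : nat -> nat) (mpos : forall n, (0 < m n)%N) (km : forall n, (k <= m n)%N)
  (Hratio : forall M : R, \forall n \near \oo,
      M * ((n%:R : R) `^ (2%:R / (k * g.+1)%:R)
           * ((maxdeg (G n))%:R : R) `^ ((2 * g)%:R / (k * g.+1)%:R))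
      <= (m n)%:R)
  (Hm : forall n, (3 * k ^ 2 * maxdeg (G n) <= m n)%N) :
  (fun n => prob_km_colourable R k (m n) (G n)) @ \oo --> (1 : R).
Proof.
have k0 : (0 < k)%N by apply: leq_trans Hk.
set q := (k * g.+1)%N in Hratio *.
have q0 : (0 < q)%N by rewrite muln_gt0 k0.
pose c : R := (g.+1 * (k * g.+1) ^ k)%:R ^+ g.+1 + 1.
have c0 : 0 < c by rewrite ltr_pwDr // exprn_ge0.
have [T HT] := @log_scale_le k g k0.
apply/cvgrPdist_le => e e0.
(* The term [2 * c / e] makes the sum over small sets at most [c / M <= e / 2]; the 1 ensures
   [M <= M ^+ q]. *)
pose M : R := 1 + 2 * c / e.
have M1 : 1 <= M by rewrite lerDl divr_ge0 ?mulr_ge0 // ltW.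
have M0 : 0 < M by apply: lt_le_trans M1.
near=> n.
pose S := (100 * (trunc_log 2 n).+1)%N.
pose mu : R := Num.sqrt (m n)%:R.
have mu1 : 1 <= mu by rewrite -sqrtr1 ler_sqrt // ler1n.
have mu0 : 0 < mu by apply: lt_le_trans mu1.
have mu2 : mu ^+ 2 = (m n)%:R by rewrite sqr_sqrtr.
have nT : (2 ^ T <= n)%N by near: n; exact: nbhs_infty_ge.
(* This brings the exploration tail [3 / n] below [e / 2]. *)
have ne : 6 / e <= n%:R :> R by near: n; exact: nbhs_infty_ger.
have HM : M ^+ q * (n%:R * (maxdeg (G n))%:R ^+ g) <= mu ^+ q.
  by apply: ratio_bound => //; [exact: ltW | near: n; exact: Hratio].
have n0 : 0 < (n%:R : R) by apply: lt_le_trans ne; rewrite divr_gt0.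
apply: le_trans (prob_ge R S (Gsym n) (Girr n) (Gfree n) Hg.1 (mpos n) (km n) (Hm n)) _.
rewrite -/mu.
apply: (@le_trans _ _ (e / 2 + e / 2)); last by rewrite -splitr.
apply: lerD; last first.
  apply: le_trans (geometric_tail_le R n) _.
  rewrite ler_pdivrMr //; move: ne; rewrite ler_pdivrMr // => ne.
  by rewrite mulrAC ler_pdivlMr // [leRHS]mulrC; lra.
apply: le_trans (sum_terms_le n Hk mu1 _ _) _.
- rewrite mu2 ler_nat; apply: leq_trans (Hm n).
  by rewrite leq_pmull // muln_gt0 expn_gt0 k0.
(* For positive degree, [n <= mu ^+ q] follows from [HM], and [q]-th powers are compared. For degree
   0 and [g > 0], [HM] gives no lower bound on [mu], hence the separate case. *)
- have [D0|D0] := posnP (maxdeg (G n)); [by left | right].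
  rewrite -(@ler_pXn2r _ q) ?nnegrE // ?(ltW mu0) //.
  apply: le_trans HM; apply: (@le_trans _ _ n%:R).
    by rewrite -natrX ler_nat; exact: HT.
  rewrite -[leLHS]mul1r ler_pM ?exprn_ege1 // ler_peMr //.
  by rewrite exprn_ege1 // ler1n.
rewrite -/q -/c.
have Mq : M <= M ^+ q by rewrite -{1}(expr1 M) ler_weXn2l.
apply: (@le_trans _ _ (M^-1 * c)).
  rewrite ler_wpM2r ?(ltW c0) // ler_pdivrMr ?exprn_gt0 // ler_pdivlMl //.
  apply: le_trans HM; rewrite ler_wpM2r // mulr_ge0 // exprn_ge0 //.
rewrite ler_pdivrMl // /M mulrDl mul1r.
rewrite (_ : 2 * c / e * (e / 2) = c); first by rewrite lerDr divr_ge0 // ltW.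
by field; rewrite gt_eqF.
Unshelve. all: by end_near.
Qed.
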